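(* Let $\varphi$ be a formula in the language of $\mathsf{E}\text{-}\mathsf{HA}^\omega$ (i.e. of $\mathsf{HA}^\omega$) with free variables $x_1,\ldots,x_n$ of types $\sigma_1,\ldots,\sigma_n$, and let $\varphi^*$ be the formula of the language of $\mathsf{HE}\text{-}\mathsf{HA}^\omega$ obtained from $\varphi$ by replacing every $s\equiv_\sigma t$ by $s=_\sigma t$, every $\forall x:\sigma$ by $\forall^{\mathrm{Ext}}x:\sigma$ and every $\exists x:\sigma$ by $\exists^{\mathrm{Ext}}x:\sigma$. Then $\mathsf{E}\text{-}\mathsf{HA}^\omega\vdash\varphi$ if and only if $\mathsf{HE}\text{-}\mathsf{HA}^\omega\vdash\mathrm{Ext}_{\sigma_1}(x_1)\to\cdots\to\mathrm{Ext}_{\sigma_n}(x_n)\to\varphi^*$.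
   Context: Finite types are generated by: $0$ is a type; if $\sigma,\tau$ are types, so are $\sigma\times\tau$ and $\sigma\to\tau$. $\mathsf{HA}^\omega$ is the many-sorted intuitionistic first-order theory whose sorts are the finite types. Its terms are built from variables and, for all types $\rho,\sigma,\tau$, the constants $\mathsf{k}:\rho\to\sigma\to\rho$, $\mathsf{s}:(\rho\to\sigma\to\tau)\to(\rho\to\sigma)\to(\rho\to\tau)$, $\mathsf{pair}:\sigma\to\tau\to\sigma\times\tau$, $\mathsf{fst}:\sigma\times\tau\to\sigma$, $\mathsf{snd}:\sigma\times\tau\to\tau$, $0:0$, $S:0\to0$, $\mathsf{R}:\sigma\to(0\to\sigma\to\sigma)\to0\to\sigma$, by application (associating to the left). Atomic formulas are $\bot$ and $s\equiv_\sigma t$. Axioms: $\equiv_\sigma$ is an equivalence relation; $x\equiv x'\to y\equiv y'\to xy\equiv x'y'$; $\mathsf{k}xy\equiv x$; $\mathsf{s}xyz\equiv xz(yz)$; $\mathsf{fst}(\mathsf{pair}\,xy)\equiv x$; $\mathsf{snd}(\mathsf{pair}\,xy)\equiv y$; $\mathsf{R}xy0\equiv x$; $\mathsf{R}xy(Sm)\equiv ym(\mathsf{R}xym)$; $Sx\equiv_0Sy\to x\equiv_0y$; $\neg(Sx\equiv_00)$; induction for all formulas. $\mathsf{E}\text{-}\mathsf{HA}^\omega$ is $\mathsf{HA}^\omega$ plus $x\equiv_{\sigma\times\tau}y\leftrightarrow(\mathsf{fst}\,x\equiv_\sigma\mathsf{fst}\,y\wedge\mathsf{snd}\,x\equiv_\tau\mathsf{snd}\,y)$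 and $f\equiv_{\sigma\to\tau}g\leftrightarrow\forall x:\sigma.fx\equiv_\tau gx$ for all $\sigma,\tau$. $\mathsf{H}\text{-}\mathsf{HA}^\omega$ extends the language of $\mathsf{HA}^\omega$ with, for each type $\sigma$, a unary predicate $\mathrm{Ext}_\sigma$ and a binary predicate $=_\sigma$; $\forall^{\mathrm{Ext}}x:\sigma.\psi$ abbreviates $\forall x:\sigma(\mathrm{Ext}_\sigma(x)\to\psi)$ and $\exists^{\mathrm{Ext}}x:\sigma.\psi$ abbreviates $\exists x:\sigma(\mathrm{Ext}_\sigma(x)\wedge\psi)$. Its axioms are those of $\mathsf{HA}^\omega$, induction for all formulas of the extended language, and for all $\sigma,\tau$: $x=_0y\leftrightarrow x\equiv_0y$; $\forall x:0\,\mathrm{Ext}_0(x)$; $x=_{\sigma\times\tau}y\leftrightarrow(\mathsf{fst}\,x=_\sigma\mathsf{fst}\,y\wedge\mathsf{snd}\,x=_\tau\mathsf{snd}\,y)$; $\mathrm{Ext}_{\sigma\times\tau}(x)\leftrightarrow(\mathrm{Ext}_\sigma(\mathsf{fst}\,x)\wedge\mathrm{Ext}_\tau(\mathsf{snd}\,x))$; $f=_{\sigma\to\tau}g\leftrightarrow\forall^{\mathrm{Ext}}x:\sigma.fx=_\tau gx$; $\mathrm{Ext}_{\sigma\to\tau}(f)\to\mathrm{Ext}_\sigma(x)\to\mathrm{Ext}_\tau(fx)$; $x\equiv_\sigma y\to\mathrm{Ext}_\sigma(x)\to\mathrm{Ext}_\sigma(y)$; $\mathrm{Ext}(c)$ for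 each constant $c$. $\mathsf{HE}\text{-}\mathsf{HA}^\omega$ is $\mathsf{H}\text{-}\mathsf{HA}^\omega$ plus, for all $\sigma,\tau$, the axiom $\mathrm{Ext}_{\sigma\to\tau}(f)\to\mathrm{Ext}_\sigma(x)\to\mathrm{Ext}_\sigma(y)\to x=_\sigma y\to fx=_\tau fy$. *)

(* Defs.v *)
From Stdlib Require Import List.
Import ListNotations.

Set Implicit Arguments.
Unset Strict Implicit.
Unset Printing Implicit Defensive.

Inductive ty : Type :=
| tnat : ty
| tprod : ty -> ty -> ty
| tarr : ty -> ty -> ty.

Declare Scope ty_scope.
Delimit Scope ty_scope with ty.
Bind Scope ty_scope with ty.
Notation "0" := tnat : ty_scope.
Notation "s * t" := (tprod s t) : ty_scope.
Notation "s ~> t" := (tarr s t) (at level 55, right associativity) : ty_scope.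

(* Syntax is intrinsically typed with de Bruijn variables: [tm G s] is the set
   of terms of type [s], and [form L G] the set of formulas, whose free
   variables are among x_1, ..., x_n of the types listed in [G]; x_1 is the
   variable [vz], x_2 is [vs vz], and so on.  A quantifier over [s] binds the
   head variable of [s :: G]. *)
Definition ctx : Type := list ty.

Inductive var : ctx -> ty -> Type :=
| vz (G : ctx) (s : ty) : var (s :: G) s
| vs (G : ctx) (s t : ty) : var G t -> var (s :: G) t.
Arguments vz {G s}.
Arguments vs {G s t} x.

Inductive cst : ty -> Type :=
| ck (r s : ty) : cst (r ~> s ~> r)
| cs (r s t : ty) : cst ((r ~> s ~> t) ~> (r ~> s) ~> (r ~> t))
| cpair (s t : ty) : cst (s ~> t ~> s * t)
| cfst (s t : ty) : cst (s * t ~> s)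
| csnd (s t : ty) : cst (s * t ~> t)
| czero : cst 0
| csucc : cst (0 ~> 0)
| crec (s : ty) : cst (s ~> (0 ~> s ~> s) ~> 0 ~> s).

Inductive tm (G : ctx) : ty -> Type :=
| Var (s : ty) (x : var G s) : tm G s
| Cst (s : ty) (c : cst s) : tm G s
| App (s t : ty) (f : tm G (s ~> t)) (a : tm G s) : tm G t.
Arguments Cst {G s} c.

Declare Scope tm_scope.
Delimit Scope tm_scope with tm.
Bind Scope tm_scope with tm.
Local Open Scope tm_scope.
Infix "@" := App (at level 32, left associativity) : tm_scope.

Definition tK {G} (r s : ty) : tm G (r ~> s ~> r) := Cst (ck r s).
Definition tS {G} (r s t : ty) : tm G ((r ~> s ~> t) ~> (r ~> s) ~> (r ~> t)) :=
  Cst (cs r s t).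
Definition tPair {G} {s t : ty} (a : tm G s) (b : tm G t) : tm G (s * t) :=
  Cst (cpair s t) @ a @ b.
Definition tFst {G} {s t : ty} (p : tm G (s * t)) : tm G s := Cst (cfst s t) @ p.
Definition tSnd {G} {s t : ty} (p : tm G (s * t)) : tm G t := Cst (csnd s t) @ p.
Definition tZero {G} : tm G 0 := Cst czero.
Definition tSucc {G} (m : tm G 0) : tm G 0 := Cst csucc @ m.
Definition tRec {G} (s : ty) : tm G (s ~> (0 ~> s ~> s) ~> 0 ~> s) := Cst (crec s).

(* [LHA] is the language of HA^omega, [LH] its extension by Ext and =. *)
Inductive lang : Set := LHA | LH.

Inductive atom (G : ctx) : lang -> Type :=
| aeqv (L : lang) (s : ty) : tm G s -> tm G s -> atom G L
| aeq (s : ty) : tm G s -> tm G s -> atom G LH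
| aext (s : ty) : tm G s -> atom G LH.

Inductive form (L : lang) (G : ctx) : Type :=
| Bot : form L G
| Atom : atom G L -> form L G
| And : form L G -> form L G -> form L G
| Or : form L G -> form L G -> form L G
| Imp : form L G -> form L G -> form L G
| All (s : ty) : form L (s :: G) -> form L G
| Ex (s : ty) : form L (s :: G) -> form L G.
Arguments Bot {L G}.
Arguments All {L G} s p.
Arguments Ex {L G} s p.

Definition Eqv {L G} {s : ty} (a b : tm G s) : form L G := Atom (aeqv L a b).
Definition Eq {G} {s : ty} (a b : tm G s) : form LH G := Atom (aeq a b).
Definition Ext {G} {s : ty} (a : tm G s) : form LH G := Atom (aext a).
Definition Neg {L G} (p : form L G) : form L G := Imp p Bot.
Definition Iff {L G} (p q : form L G) : form L G := And (Imp p q) (Imp q p).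

Declare Scope form_scope.
Delimit Scope form_scope with form.
Bind Scope form_scope with form.
Local Open Scope form_scope.
Infix "==" := Eqv (at level 70, no associativity) : form_scope.
Infix "=" := Eq : form_scope.
Infix "/\" := And : form_scope.
Infix "\/" := Or : form_scope.
Infix "-->" := Imp (at level 90, right associativity) : form_scope.
Infix "<-->" := Iff (at level 95, no associativity) : form_scope.

Definition AllExt {G} (s : ty) (p : form LH (s :: G)) : form LH G :=
  All s (Ext (Var vz) --> p).
Definition ExExt {G} (s : ty) (p : form LH (s :: G)) : form LH G :=
  Ex s (Ext (Var vz) /\ p).

Definition ren (G D : ctx) : Type := forall s : ty, var G s -> var D s.
Definition sub (G D : ctx) : Type := forall s : ty, var G s -> tm D s.

Definition extend (T : ty -> Type) (G : ctx) (u : ty) (h : T u)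
    (f : forall s, var G s -> T s) (s : ty) (x : var (u :: G) s) : T s :=
  match x in var G' s' return
    match G' with
    | [] => unit
    | u' :: G0 => T u' -> (forall s, var G0 s -> T s) -> T s'
    end with
  | vz => fun h _ => h
  | vs y => fun _ f => f _ y
  end h f.

Definition ren_up (G D : ctx) (u : ty) (r : ren G D) : ren (u :: G) (u :: D) :=
  extend (T := var (u :: D)) vz (fun s x => vs (r s x)).

Fixpoint ren_tm (G D : ctx) (r : ren G D) (s : ty) (a : tm G s) : tm D s :=
  match a with
  | Var x => Var (r _ x)
  | Cst c => Cst c
  | App f b => ren_tm r f @ ren_tm r b
  end.

Definition wk (G : ctx) (u s : ty) (a : tm G s) : tm (u :: G) s :=
  ren_tm (fun _ x => vs x) a.
Arguments wk {G} u {s} a.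

Definition sub_up (G D : ctx) (u : ty) (r : sub G D) : sub (u :: G) (u :: D) :=
  extend (T := tm (u :: D)) (Var vz) (fun s x => wk u (r s x)).

Fixpoint sub_tm (G D : ctx) (r : sub G D) (s : ty) (a : tm G s) : tm D s :=
  match a with
  | Var x => r _ x
  | Cst c => Cst c
  | App f b => sub_tm r f @ sub_tm r b
  end.

Definition sub_atom (L : lang) (G D : ctx) (r : sub G D) (a : atom G L) : atom D L :=
  match a with
  | aeqv L a b => aeqv L (sub_tm r a) (sub_tm r b)
  | aeq a b => aeq (sub_tm r a) (sub_tm r b)
  | aext a => aext (sub_tm r a)
  end.

Fixpoint sub_form (L : lang) (G D : ctx) (r : sub G D) (p : form L G) : form L D :=
  match p with
  | Bot => Bot
  | Atom a => Atom (sub_atom r a)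
  | And p q => sub_form r p /\ sub_form r q
  | Or p q => sub_form r p \/ sub_form r q
  | Imp p q => sub_form r p --> sub_form r q
  | All s p => All s (sub_form (sub_up r) p)
  | Ex s p => Ex s (sub_form (sub_up r) p)
  end.

Definition wk_form (L : lang) (G : ctx) (u : ty) (p : form L G) : form L (u :: G) :=
  sub_form (fun _ x => Var (vs x)) p.
Arguments wk_form {L G} u p.

Definition inst (L : lang) (G : ctx) (u : ty) (p : form L (u :: G)) (a : tm G u) :
    form L G :=
  sub_form (extend (T := tm G) a (fun _ x => Var x)) p.

(* [p(S x)] for a formula [p(x)], where x is the head variable. *)
Definition at_succ (L : lang) (G : ctx) (p : form L (0%ty :: G)) : form L (0%ty :: G) :=
  sub_form (extend (T := tm (0%ty :: G)) (tSucc (Var vz)) (fun _ x => Var (vs x))) p.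

Definition theory (L : lang) : Type := forall G : ctx, form L G -> Prop.

(* Intuitionistic natural deduction.  Restricting the free variables of a
   derivation to the current context is harmless, since every type is
   inhabited by a closed term. *)
Inductive prv (L : lang) (T : theory L) : forall G : ctx, list (form L G) -> form L G -> Prop :=
| prv_ax G H (p : form L G) : T G p -> prv T H p
| prv_hyp G H (p : form L G) : In p H -> prv T H p
| prv_botE G H (p : form L G) : prv T H Bot -> prv T H p
| prv_andI G H (p q : form L G) : prv T H p -> prv T H q -> prv T H (p /\ q)
| prv_andE1 G H (p q : form L G) : prv T H (p /\ q) -> prv T H p
| prv_andE2 G H (p q : form L G) : prv T H (p /\ q) -> prv T H q
| prv_orI1 G H (p q : form L G) : prv T H p -> prv T H (p \/ q)
| prv_orI2 G H (p q : form L G) : prv T H q -> prv T H (p \/ q)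
| prv_orE G H (p q r : form L G) :
    prv T H (p \/ q) -> prv T (p :: H) r -> prv T (q :: H) r -> prv T H r
| prv_impI G H (p q : form L G) : prv T (p :: H) q -> prv T H (p --> q)
| prv_impE G H (p q : form L G) : prv T H (p --> q) -> prv T H p -> prv T H q
| prv_allI G H (s : ty) (p : form L (s :: G)) :
    prv T (map (wk_form s) H) p -> prv T H (All s p)
| prv_allE G H (s : ty) (p : form L (s :: G)) (a : tm G s) :
    prv T H (All s p) -> prv T H (inst p a)
| prv_exI G H (s : ty) (p : form L (s :: G)) (a : tm G s) :
    prv T H (inst p a) -> prv T H (Ex s p)
| prv_exE G H (s : ty) (p : form L (s :: G)) (q : form L G) :
    prv T H (Ex s p) -> prv T (p :: map (wk_form s) H) (wk_form s q) -> prv T H q.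

Definition provable (L : lang) (T : theory L) (G : ctx) (p : form L G) : Prop :=
  prv T [] p.

(* In the axioms below, free variables are replaced by arbitrary terms. *)

(* The axioms of HA^omega, with induction for all formulas of the language [L]. *)
Inductive HA (L : lang) (G : ctx) : form L G -> Prop :=
| HA_refl (s : ty) (x : tm G s) : HA (x == x)
| HA_sym (s : ty) (x y : tm G s) : HA (x == y --> y == x)
| HA_trans (s : ty) (x y z : tm G s) : HA (x == y --> y == z --> x == z)
| HA_cong (s t : ty) (x x' : tm G (s ~> t)) (y y' : tm G s) :
    HA (x == x' --> y == y' --> x @ y == x' @ y')
| HA_k (r s : ty) (x : tm G r) (y : tm G s) : HA (tK r s @ x @ y == x)
| HA_s (r s t : ty) (x : tm G (r ~> s ~> t)) (y : tm G (r ~> s)) (z : tm G r) :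
    HA (tS r s t @ x @ y @ z == x @ z @ (y @ z))
| HA_fst (s t : ty) (x : tm G s) (y : tm G t) : HA (tFst (tPair x y) == x)
| HA_snd (s t : ty) (x : tm G s) (y : tm G t) : HA (tSnd (tPair x y) == y)
| HA_rec0 (s : ty) (x : tm G s) (y : tm G (0 ~> s ~> s)) :
    HA (tRec s @ x @ y @ tZero == x)
| HA_recS (s : ty) (x : tm G s) (y : tm G (0 ~> s ~> s)) (m : tm G 0) :
    HA (tRec s @ x @ y @ tSucc m == y @ m @ (tRec s @ x @ y @ m))
| HA_Sinj (x y : tm G 0) : HA (tSucc x == tSucc y --> x == y)
| HA_S0 (x : tm G 0) : HA (Neg (tSucc x == tZero))
| HA_induction (p : form L (0%ty :: G)) :
    HA (inst p tZero --> All 0 (p --> at_succ p) --> All 0 p).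

Inductive E_HA (G : ctx) : form LHA G -> Prop :=
| E_HA_base (p : form LHA G) : HA p -> E_HA p
| E_HA_prod (s t : ty) (x y : tm G (s * t)) :
    E_HA (x == y <--> tFst x == tFst y /\ tSnd x == tSnd y)
| E_HA_fun (s t : ty) (f g : tm G (s ~> t)) :
    E_HA (f == g <--> All s (wk s f @ Var vz == wk s g @ Var vz)).

Inductive H_HA (G : ctx) : form LH G -> Prop :=
| H_HA_base (p : form LH G) : HA p -> H_HA p
| H_HA_eq0 (x y : tm G 0) : H_HA (x = y <--> x == y)
| H_HA_ext0 : H_HA (All 0 (Ext (Var vz)))
| H_HA_eq_prod (s t : ty) (x y : tm G (s * t)) :
    H_HA (x = y <--> tFst x = tFst y /\ tSnd x = tSnd y)
| H_HA_ext_prod (s t : ty) (x : tm G (s * t)) :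
    H_HA (Ext x <--> Ext (tFst x) /\ Ext (tSnd x))
| H_HA_eq_fun (s t : ty) (f g : tm G (s ~> t)) :
    H_HA (f = g <--> AllExt (wk s f @ Var vz = wk s g @ Var vz))
| H_HA_ext_app (s t : ty) (f : tm G (s ~> t)) (x : tm G s) :
    H_HA (Ext f --> Ext x --> Ext (f @ x))
| H_HA_ext_eqv (s : ty) (x y : tm G s) : H_HA (x == y --> Ext x --> Ext y)
| H_HA_ext_cst (s : ty) (c : cst s) : H_HA (Ext (Cst c)).

Inductive HE_HA (G : ctx) : form LH G -> Prop :=
| HE_HA_base (p : form LH G) : H_HA p -> HE_HA p
| HE_HA_ext (s t : ty) (f : tm G (s ~> t)) (x y : tm G s) :
    HE_HA (Ext f --> Ext x --> Ext y --> x = y --> f @ x = f @ y).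

(* Only the first case arises for atoms of the language of HA^omega. *)
Definition star_atom (L : lang) (G : ctx) (a : atom G L) : form LH G :=
  match a with
  | aeqv _ x y => x = y
  | aeq x y => x = y
  | aext x => Ext x
  end.

Fixpoint star (G : ctx) (p : form LHA G) : form LH G :=
  match p with
  | Bot => Bot
  | Atom a => star_atom a
  | And p q => star p /\ star q
  | Or p q => star p \/ star q
  | Imp p q => star p --> star q
  | All s p => AllExt (star p)
  | Ex s p => ExExt (star p)
  end.

(* The variables x_1, ..., x_n of a context, in order. *)
Fixpoint vars (G : ctx) : list {s : ty & var G s} :=
  match G with
  | [] => []
  | s :: G =>
      existT (var (s :: G)) s vz
        :: map (fun v => existT (var (s :: G)) (projT1 v) (vs (projT2 v))) (vars G)
  end.

(* Ext(x_1) -> ... -> Ext(x_n) -> p *)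
Definition ext_premises (G : ctx) (p : form LH G) : form LH G :=
  fold_right (fun v q => Ext (Var (projT2 v)) --> q) p (vars G).

(* Main.v *)
From Stdlib Require Import List.
Require Import Defs.
Import ListNotations.

Set Implicit Arguments.
Unset Strict Implicit.
Unset Printing Implicit Defensive.

(** From left to right, induction on derivations: closed terms are extensional,
    so every term is once its variables are, and [a ≡ b] implies [a = b] at
    each type, so each axiom of E-HA^omega has a provable star.
    From right to left, read [Ext] as truth and [=] as [≡]: this turns every
    axiom of HE-HA^omega into a theorem of E-HA^omega, and the star of [p]
    into a formula equivalent to [p]. *)

(** * Substitution calculus for typed de Bruijn syntax *)

Lemma extend_ext (T : ty -> Type) (G : ctx) (u : ty) (h : T u)
    (f g : forall s, var G s -> T s) :
  (forall s x, f s x = g s x) ->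
  forall s (x : var (u :: G) s), extend h f x = extend h g x.
Proof.
  intros e s x.
  (* Inversion of a variable in a non-empty context: the motive is trivial at [[]] and requantifies
     everything that depends on the head type and the tail. *)
  refine (match x in var G' s' return
    match G' return var G' s' -> Prop with
    | [] => fun _ => True
    | u' :: G0 => fun x => forall (h : T u') (f g : forall s, var G0 s -> T s),
        (forall s x, f s x = g s x) -> extend h f x = extend h g x
    end x with vz => _ | vs y => _ end h f g e); simpl; auto.
Qed.

(** Taking [k] to be a substitution on terms, this computes the composite of that substitution with
    a lifted one. *)
Lemma extend_comp (T U : ty -> Type) (k : forall s, T s -> U s) (G : ctx) (u : ty)
    (h : T u) (f : forall s, var G s -> T s) s (x : var (u :: G) s) :
  k s (extend h f x) = extend (T := U) (k u h) (fun s x => k s (f s x)) x.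
Proof.
  refine (match x in var G' s' return
    match G' return var G' s' -> Prop with
    | [] => fun _ => True
    | u' :: G0 => fun x => forall (h : T u') (f : forall s, var G0 s -> T s),
        k s' (extend h f x) = extend (T := U) (k u' h) (fun s x => k s (f s x)) x
    end x with vz => _ | vs y => _ end h f); simpl; auto.
Qed.

Lemma extend_eta (T : ty -> Type) (G : ctx) (u : ty)
    (f : forall s, var (u :: G) s -> T s) s (x : var (u :: G) s) :
  extend (f u vz) (fun s y => f s (vs y)) x = f s x.
Proof.
  refine (match x in var G' s' return
    match G' return var G' s' -> Prop with
    | [] => fun _ => True
    | u' :: G0 => fun x => forall (f : forall s, var (u' :: G0) s -> T s),
        extend (f u' vz) (fun s y => f s (vs y)) x = f s' x
    end x with vz => _ | vs y => _ end f); simpl; auto.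
Qed.

Lemma sub_tm_ext G D (r q : sub G D) (e : forall s x, r s x = q s x) s (a : tm G s) :
  sub_tm r a = sub_tm q a.
Proof. induction a; simpl; congruence. Qed.

Lemma sub_tm_var G s (a : tm G s) : sub_tm (fun s x => Var x) a = a.
Proof. induction a; simpl; congruence. Qed.

Lemma sub_tm_ren G D E (r : sub D E) (q : ren G D) s (a : tm G s) :
  sub_tm r (ren_tm q a) = sub_tm (fun s x => r s (q s x)) a.
Proof. induction a; simpl; congruence. Qed.

Lemma ren_tm_sub G D E (r : ren D E) (q : sub G D) s (a : tm G s) :
  ren_tm r (sub_tm q a) = sub_tm (fun s x => ren_tm r (q s x)) a.
Proof. induction a; simpl; congruence. Qed.

Lemma sub_tm_sub G D E (r : sub D E) (q : sub G D) s (a : tm G s) :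
  sub_tm r (sub_tm q a) = sub_tm (fun s x => sub_tm r (q s x)) a.
Proof. induction a; simpl; congruence. Qed.

Lemma sub_tm_wk G u s (a : tm G s) : sub_tm (fun s x => Var (vs x)) a = wk u a.
Proof. unfold wk. induction a; simpl; congruence. Qed.

(** A weakened term does not contain the head variable, so the value [b] is never inserted. *)
Lemma sub_tm_extend_wk G D u (b : tm D u) (r : sub G D) s (a : tm G s) :
  sub_tm (extend (T := tm D) b r) (wk u a) = sub_tm r a.
Proof. unfold wk. rewrite sub_tm_ren. reflexivity. Qed.

Lemma sub_up_wk G D u (r : sub G D) s (a : tm G s) :
  sub_tm (sub_up r) (wk u a) = wk u (sub_tm r a).
Proof.
  unfold sub_up. rewrite sub_tm_extend_wk. unfold wk. now rewrite ren_tm_sub.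
Qed.

Lemma sub_up_ext G D u (r q : sub G D) :
  (forall s x, r s x = q s x) ->
  forall s (x : var (u :: G) s), sub_up r x = sub_up q x.
Proof. intros e. apply extend_ext. intros s x. now rewrite e. Qed.

Lemma sub_up_comp G D E u (r : sub D E) (q : sub G D) s (x : var (u :: G) s) :
  sub_tm (sub_up r) (sub_up q x) = sub_up (fun s x => sub_tm r (q s x)) x.
Proof.
  unfold sub_up at 2. rewrite (extend_comp (fun s (a : tm _ s) => sub_tm (sub_up r) a)).
  apply extend_ext. intros. apply sub_up_wk.
Qed.

Lemma sub_up_var G u s (x : var (u :: G) s) : sub_up (fun s (x : var G s) => Var x) x = Var x.
Proof. apply (extend_eta (fun s (x : var (u :: G) s) => Var x)). Qed.

(** Substitutions are functions and are compared pointwise, which avoids functional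
    extensionality. *)
Lemma sub_form_ext L G D (r q : sub G D) (p : form L G) :
  (forall s x, r s x = q s x) -> sub_form r p = sub_form q p.
Proof.
  intros e. revert D r q e. induction p; intros D r q e; simpl; f_equal; auto.
  - destruct a; simpl; f_equal; now apply sub_tm_ext.
  - apply IHp. now apply sub_up_ext.
  - apply IHp. now apply sub_up_ext.
Qed.

(** The hypothesis is pointwise because lifting the identity under a binder gives the identity only
    pointwise. *)
Lemma sub_form_var L G (r : sub G G) (p : form L G) :
  (forall s x, r s x = Var x) -> sub_form r p = p.
Proof.
  revert r. induction p; intros r e; simpl; f_equal; auto.
  - destruct a; simpl; f_equal; rewrite (sub_tm_ext e); apply sub_tm_var.
  - apply IHp. intros. rewrite (sub_up_ext e). apply sub_up_var.
  - apply IHp. intros. rewrite (sub_up_ext e). apply sub_up_var.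
Qed.

Lemma sub_form_sub L G D E (r : sub D E) (q : sub G D) (p : form L G) :
  sub_form r (sub_form q p) = sub_form (fun s x => sub_tm r (q s x)) p.
Proof.
  revert D E r q. induction p; intros D E r q; simpl; f_equal; auto.
  - destruct a; simpl; f_equal; apply sub_tm_sub.
  - rewrite IHp. apply sub_form_ext. intros. apply sub_up_comp.
  - rewrite IHp. apply sub_form_ext. intros. apply sub_up_comp.
Qed.

(** Lets the quantifier rules be used with the freshly bound variable itself as the instance. *)
Lemma inst_wk_up L G u (p : form L (u :: G)) :
  inst (sub_form (sub_up (fun s x => Var (vs x))) p) (Var vz) = p.
Proof.
  unfold inst. rewrite sub_form_sub. apply sub_form_var. intros s x.
  unfold sub_up.
  rewrite (extend_comp
    (fun s (a : tm _ s) => sub_tm (extend (T := tm (u :: G)) (Var vz) (fun _ x => Var x)) a)).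
  apply (extend_eta (fun s (x : var (u :: G) s) => Var x)).
Qed.

(** * Derived rules of natural deduction *)

Section Derived.

Variables (L : lang) (T : theory L).

Lemma prv_mono G H H' (p : form L G) : prv T H p -> incl H H' -> prv T H' p.
Proof.
  intros d. revert H'.
  assert (cons_incl : forall G (q : form L G) H H', incl H H' -> incl (q :: H) (q :: H'))
    by (intros; apply incl_cons; [now left | now apply incl_tl]).
  induction d; intros H' i.
  - now apply prv_ax.
  - apply prv_hyp. auto.
  - apply prv_botE. auto.
  - apply prv_andI; auto.
  - eapply prv_andE1; eauto.
  - eapply prv_andE2; eauto.
  - apply prv_orI1; auto.
  - apply prv_orI2; auto.
  - eapply prv_orE; eauto.
  - apply prv_impI; auto.
  - eapply prv_impE; eauto.
  - apply prv_allI. apply IHd. now apply incl_map.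
  - apply prv_allE; auto.
  - eapply prv_exI; eauto.
  - eapply prv_exE; [eauto|]. apply IHd2. apply cons_incl. now apply incl_map.
Qed.

Lemma prv_wk_allE G s (H : list (form L (s :: G))) (p : form L (s :: G)) :
  prv T H (wk_form s (All s p)) -> prv T H p.
Proof. intros d. rewrite <- (inst_wk_up p). now apply prv_allE. Qed.

Lemma prv_wk_exI G s (H : list (form L (s :: G))) (p : form L (s :: G)) :
  prv T H p -> prv T H (wk_form s (Ex s p)).
Proof. intros d. apply prv_exI with (a := Var vz). now rewrite inst_wk_up. Qed.

Lemma prv_imp_trans G H (p q r : form L G) :
  prv T H (p --> q) -> prv T H (q --> r) -> prv T H (p --> r).
Proof.
  intros d e. apply prv_impI. eapply prv_impE.
  - eapply prv_mono; [exact e | now apply incl_tl].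
  - eapply prv_impE; [|apply prv_hyp; now left].
    eapply prv_mono; [exact d | now apply incl_tl].
Qed.

Lemma prv_imp_all G H s (p q : form L (s :: G)) :
  prv T (map (wk_form s) H) (p --> q) -> prv T H (All s p --> All s q).
Proof.
  intros d. apply prv_impI, prv_allI. eapply prv_impE.
  - eapply prv_mono; [exact d | now apply incl_tl].
  - apply prv_wk_allE, prv_hyp. now left.
Qed.

Lemma prv_imp_ex G H s (p q : form L (s :: G)) :
  prv T (map (wk_form s) H) (p --> q) -> prv T H (Ex s p --> Ex s q).
Proof.
  intros d. apply prv_impI. eapply prv_exE; [apply prv_hyp; now left|].
  apply prv_wk_exI. eapply prv_impE; [|apply prv_hyp; now left].
  eapply prv_mono; [exact d | now do 2 apply incl_tl].
Qed.

Lemma prv_imp_and G H (p p' q q' : form L G) :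
  prv T H (p --> p') -> prv T H (q --> q') -> prv T H (And p q --> And p' q').
Proof.
  intros d e. apply prv_impI, prv_andI.
  - eapply prv_impE; [eapply prv_mono; [exact d | now apply incl_tl]|].
    eapply prv_andE1, prv_hyp. now left.
  - eapply prv_impE; [eapply prv_mono; [exact e | now apply incl_tl]|].
    eapply prv_andE2, prv_hyp. now left.
Qed.

Lemma prv_imp_or G H (p p' q q' : form L G) :
  prv T H (p --> p') -> prv T H (q --> q') -> prv T H (Or p q --> Or p' q').
Proof.
  intros d e. apply prv_impI. eapply prv_orE; [apply prv_hyp; now left| |].
  - apply prv_orI1. eapply prv_impE; [|apply prv_hyp; now left].
    eapply prv_mono; [exact d | now do 2 apply incl_tl].
  - apply prv_orI2. eapply prv_impE; [|apply prv_hyp; now left].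
    eapply prv_mono; [exact e | now do 2 apply incl_tl].
Qed.

Lemma prv_imp_imp G H (p p' q q' : form L G) :
  prv T H (p' --> p) -> prv T H (q --> q') -> prv T H ((p --> q) --> (p' --> q')).
Proof.
  intros d e. apply prv_impI. eapply prv_imp_trans; [|eapply prv_imp_trans].
  - eapply prv_mono; [exact d | now apply incl_tl].
  - apply prv_hyp. now left.
  - eapply prv_mono; [exact e | now apply incl_tl].
Qed.

Lemma prv_imp_refl G H (p : form L G) : prv T H (p --> p).
Proof. apply prv_impI, prv_hyp. now left. Qed.

(** Together with [prv_imp_detach], this inserts or removes a provable guard [q] in front of [p];
    the relativized quantifiers are handled this way. *)
Lemma prv_imp_const G H (p q : form L G) : prv T H (p --> (q --> p)).
Proof. do 2 apply prv_impI. apply prv_hyp. right. now left. Qed.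

Lemma prv_imp_detach G H (p q : form L G) : prv T H q -> prv T H ((q --> p) --> p).
Proof.
  intros d. apply prv_impI. eapply prv_impE; [apply prv_hyp; now left|].
  eapply prv_mono; [exact d | now apply incl_tl].
Qed.

Lemma prv_iffE1 G H (p q : form L G) : prv T H (Iff p q) -> prv T H p -> prv T H q.
Proof. intros d. eapply prv_impE, prv_andE1, d. Qed.

Lemma prv_iffE2 G H (p q : form L G) : prv T H (Iff p q) -> prv T H q -> prv T H p.
Proof. intros d. eapply prv_impE, prv_andE2, d. Qed.

End Derived.

Ltac hyp := apply prv_hyp; simpl; tauto.

(** * The star under substitution, and equality in HE-HA^omega *)

Lemma star_sub G D (r : sub G D) (p : form LHA G) :
  star (sub_form r p) = sub_form r (star p).
Proof.
  revert D r. induction p; intros D r; simpl; try congruence.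
  - now destruct a.
  - unfold AllExt. simpl. now rewrite IHp.
  - unfold ExExt. simpl. now rewrite IHp.
Qed.

Section HE.

Variables (G : ctx) (H : list (form LH G)).

Lemma HE_ax (p : form LH G) : H_HA p -> prv HE_HA H p.
Proof. intros a. now apply prv_ax, HE_HA_base. Qed.

(** Equality at an arrow type is pointwise on extensional arguments, so evaluating at [a] costs a
    proof of [Ext a]. *)
Lemma HE_eq_app s t (f g : tm G (s ~> t)) (a : tm G s) :
  prv HE_HA H (Eq f g) -> prv HE_HA H (Ext a) -> prv HE_HA H (Eq (App f a) (App g a)).
Proof.
  intros e x.
  assert (d := prv_allE a (prv_iffE1 (HE_ax (H_HA_eq_fun f g)) e)).
  apply prv_impE with (p := Ext a); [|exact x].
  unfold inst in d. simpl in d. unfold Eq, Ext.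
  now rewrite !sub_tm_extend_wk, !sub_tm_var in d.
Qed.

Lemma HE_eq_funI s t (f g : tm G (s ~> t)) :
  prv HE_HA (Ext (Var vz) :: map (wk_form s) H)
    (Eq (App (wk s f) (Var vz)) (App (wk s g) (Var vz))) ->
  prv HE_HA H (Eq f g).
Proof.
  intros d. eapply prv_iffE2; [apply HE_ax, H_HA_eq_fun|].
  now apply prv_allI, prv_impI.
Qed.

Lemma HE_eq_prodI s t (a b : tm G (s * t)) :
  prv HE_HA H (Eq (tFst a) (tFst b)) -> prv HE_HA H (Eq (tSnd a) (tSnd b)) ->
  prv HE_HA H (Eq a b).
Proof.
  intros d e. eapply prv_iffE2; [apply HE_ax, H_HA_eq_prod|]. now apply prv_andI.
Qed.

Lemma HE_eq_fst s t (a b : tm G (s * t)) :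
  prv HE_HA H (Eq a b) -> prv HE_HA H (Eq (tFst a) (tFst b)).
Proof. intros d. eapply prv_andE1, prv_iffE1; [apply HE_ax, H_HA_eq_prod | exact d]. Qed.

Lemma HE_eq_snd s t (a b : tm G (s * t)) :
  prv HE_HA H (Eq a b) -> prv HE_HA H (Eq (tSnd a) (tSnd b)).
Proof. intros d. eapply prv_andE2, prv_iffE1; [apply HE_ax, H_HA_eq_prod | exact d]. Qed.

Lemma HE_eqv_cong s t (f g : tm G (s ~> t)) (a b : tm G s) :
  prv HE_HA H (Eqv f g) -> prv HE_HA H (Eqv a b) ->
  prv HE_HA H (Eqv (App f a) (App g b)).
Proof.
  intros d e. eapply prv_impE; [eapply prv_impE; [|exact d]|exact e].
  apply HE_ax, H_HA_base, HA_cong.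
Qed.

Lemma HE_eqv_refl s (a : tm G s) : prv HE_HA H (Eqv a a).
Proof. apply HE_ax, H_HA_base, HA_refl. Qed.

(** Constants are extensional and [Ext] is closed under application, so only the variables have to
    be assumed extensional. *)
Lemma HE_ext_tm s (a : tm G s) :
  (forall s (x : var G s), prv HE_HA H (Ext (Var x))) -> prv HE_HA H (Ext a).
Proof.
  intros v. induction a as [s x|s c|s t f IHf a IHa].
  - apply v.
  - apply HE_ax, H_HA_ext_cst.
  - eapply prv_impE; [eapply prv_impE; [|exact IHf]|exact IHa].
    apply HE_ax, H_HA_ext_app.
Qed.

End HE.

(** By induction on the type: congruence of [==] carries the relation to both projections and to the
    values of a function, where the induction hypothesis applies. *)
Lemma HE_eqv_eq s G H (a b : tm G s) : prv HE_HA H (Eqv a b --> Eq a b).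
Proof.
  revert G H a b. induction s as [|s IHs t IHt|s _ t IHt]; intros G H a b; apply prv_impI.
  - eapply prv_iffE2; [apply HE_ax, H_HA_eq0 | hyp].
  - apply HE_eq_prodI; (eapply prv_impE; [apply IHs || apply IHt|]);
      (apply HE_eqv_cong; [apply HE_eqv_refl | hyp]).
  - apply HE_eq_funI. eapply prv_impE; [apply IHt|].
    apply HE_eqv_cong; [|apply HE_eqv_refl].
    apply prv_hyp. right. left. unfold wk_form, Eqv. simpl. now rewrite !sub_tm_wk.
Qed.

Lemma HE_eqv_axiom s G H (a b : tm G s) : HA (Eqv (L := LH) a b) -> prv HE_HA H (Eq a b).
Proof. intros d. eapply prv_impE; [apply HE_eqv_eq | now apply HE_ax, H_HA_base]. Qed.

Lemma wk_form_eq G u s (a b : tm G s) : wk_form u (Eq a b) = Eq (wk u a) (wk u b).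
Proof. unfold wk_form, Eq. simpl. now rewrite !sub_tm_wk. Qed.

Lemma HE_eq_sym s G H (a b : tm G s) : prv HE_HA H (Eq a b --> Eq b a).
Proof.
  revert G H a b. induction s as [|s IHs t IHt|s _ t IHt]; intros G H a b; apply prv_impI.
  - eapply prv_iffE2; [apply HE_ax, H_HA_eq0|].
    eapply prv_impE; [apply HE_ax, H_HA_base, HA_sym|].
    eapply prv_iffE1; [apply HE_ax, H_HA_eq0 | hyp].
  - apply HE_eq_prodI; (eapply prv_impE; [apply IHs || apply IHt|]).
    + apply HE_eq_fst. hyp.
    + apply HE_eq_snd. hyp.
  - apply HE_eq_funI. eapply prv_impE; [apply IHt|].
    apply HE_eq_app; [|hyp]. simpl. rewrite wk_form_eq. hyp.
Qed.

Lemma HE_eq_trans s G H (a b c : tm G s) : prv HE_HA H (Eq a b --> Eq b c --> Eq a c).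
Proof.
  revert G H a b c.
  induction s as [|s IHs t IHt|s _ t IHt]; intros G H a b c; do 2 apply prv_impI.
  - eapply prv_iffE2; [apply HE_ax, H_HA_eq0|].
    eapply prv_impE; [eapply prv_impE; [apply HE_ax, H_HA_base, HA_trans with (y := b)|]|];
      (eapply prv_iffE1; [apply HE_ax, H_HA_eq0 | hyp]).
  - apply HE_eq_prodI.
    + eapply prv_impE; [eapply prv_impE; [apply (IHs _ _ _ (tFst b))|]|];
        apply HE_eq_fst; hyp.
    + eapply prv_impE; [eapply prv_impE; [apply (IHt _ _ _ (tSnd b))|]|];
        apply HE_eq_snd; hyp.
  - apply HE_eq_funI.
    (* The middle term is [b] at the bound variable, whose guard allows both equations to be
       evaluated there. *)
    eapply prv_impE; [eapply prv_impE; [apply (IHt _ _ _ (App (wk s b) (Var vz)))|]|];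
      (apply HE_eq_app; [|hyp]); simpl; rewrite !wk_form_eq; hyp.
Qed.

(** Passes through [App f b]: the axiom [HE_HA_ext] gives the step from [a] to [b] inside the
    extensional [f], and pointwise equality gives the step from [f] to [g]. *)
Lemma HE_eq_cong s t G H (f g : tm G (s ~> t)) (a b : tm G s) :
  prv HE_HA H (Ext f) -> prv HE_HA H (Ext a) -> prv HE_HA H (Ext b) ->
  prv HE_HA H (Eq f g) -> prv HE_HA H (Eq a b) -> prv HE_HA H (Eq (App f a) (App g b)).
Proof.
  intros ef ea eb d e.
  eapply prv_impE; [eapply prv_impE; [apply (HE_eq_trans _ _ (App f b))|]|].
  - eapply prv_impE; [|exact e].
    eapply prv_impE; [|exact eb].
    eapply prv_impE; [|exact ea].
    eapply prv_impE; [|exact ef].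
    apply prv_ax, HE_HA_ext.
  - now apply HE_eq_app.
Qed.

(** * Soundness of the star translation *)

Lemma HE_ext0 G H (a : tm G 0%ty) : prv HE_HA H (Ext a).
Proof. exact (prv_allE a (HE_ax H (H_HA_ext0 G))). Qed.

Lemma HE_star_axiom G H (p : form LHA G) :
  (forall s (x : var G s), prv HE_HA H (Ext (Var x))) ->
  E_HA p -> prv HE_HA H (star p).
Proof.
  intros v a. destruct a as [p a|s t x y|s t f g].
  (* Reflexivity and the computation rules are single equations, so they follow from their versions
     with [==]. *)
  - destruct a; try (apply HE_eqv_axiom; constructor).
    + apply HE_eq_sym.
    + apply HE_eq_trans.
    + assert (m : forall s (a : tm G s), prv HE_HA (Eq y y' :: Eq x x' :: H) (Ext a)).
      { intros u a. apply prv_mono with (H := H); [now apply HE_ext_tm|].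
        now do 2 apply incl_tl. }
      do 2 apply prv_impI. apply HE_eq_cong; try apply m; hyp.
    + apply prv_impI. eapply prv_iffE2; [apply HE_ax, H_HA_eq0|].
      eapply prv_impE; [apply HE_ax, H_HA_base, HA_Sinj|].
      eapply prv_iffE1; [apply HE_ax, H_HA_eq0 | hyp].
    + apply prv_impI. eapply prv_impE; [apply HE_ax, H_HA_base, HA_S0 with (x := x)|].
      eapply prv_iffE1; [apply HE_ax, H_HA_eq0 | hyp].
    + simpl. unfold at_succ, inst. rewrite !star_sub.
      eapply prv_impE; [apply prv_imp_imp; [apply prv_imp_refl | apply prv_imp_imp]|].
      * apply prv_imp_all, prv_imp_detach, HE_ext0.
      * apply prv_imp_all, prv_imp_const.
      * apply HE_ax, H_HA_base, (HA_induction (star p)).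
  (* The stars of the two extensionality axioms are exactly the clauses for [=] at product and arrow
     types. *)
  - apply HE_ax, H_HA_eq_prod.
  - apply HE_ax, H_HA_eq_fun.
Qed.

Definition ext_vars (G : ctx) : list (form LH G) :=
  map (fun v => Ext (Var (projT2 v))) (vars G).

Lemma ext_vars_cons G s : ext_vars (s :: G) = Ext (Var vz) :: map (wk_form s) (ext_vars G).
Proof. unfold ext_vars. simpl. now rewrite !map_map. Qed.

Lemma In_ext_vars G s (x : var G s) : In (Ext (Var x)) (ext_vars G).
Proof.
  induction x as [G s|G s t x IH]; rewrite ext_vars_cons; [now left|].
  right. apply (in_map (wk_form s)) in IH. exact IH.
Qed.

Lemma map_star_wk G s (H : list (form LHA G)) :
  map (@star _) (map (wk_form s) H) = map (wk_form s) (map (@star _) H).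
Proof. rewrite !map_map. apply map_ext. intros p. apply star_sub. Qed.

(** Extensionality of all variables in scope is carried as extra hypotheses. Under a binder this
    list gains one entry, which the guard of the relativized quantifier supplies. *)
Lemma HE_star G H (p : form LHA G) :
  prv E_HA H p -> prv HE_HA (map (@star _) H ++ ext_vars G) (star p).
Proof.
  assert (ev : forall G (H : list (form LH G)) s (a : tm G s),
    prv HE_HA (H ++ ext_vars G) (Ext a)).
  { intros G0 H0 s a. apply HE_ext_tm. intros u x.
    apply prv_hyp, in_or_app. right. apply In_ext_vars. }
  intros d. induction d; simpl in *.
  - apply HE_star_axiom; [|assumption]. intros. apply ev.
  - apply prv_hyp, in_or_app. left. now apply in_map.
  - now apply prv_botE.
  - now apply prv_andI.
  - eapply prv_andE1; eauto.
  - eapply prv_andE2; eauto.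
  - now apply prv_orI1.
  - now apply prv_orI2.
  - eapply prv_orE; eauto.
  - now apply prv_impI.
  - eapply prv_impE; eauto.
  - apply prv_allI, prv_impI. eapply prv_mono; [exact IHd|].
    rewrite ext_vars_cons, map_star_wk, map_app.
    intros q. rewrite !in_app_iff. simpl. rewrite in_app_iff. tauto.
  (* The guard at the instance [a] holds because all variables of [a] are assumed extensional. *)
  - unfold inst. rewrite star_sub. eapply prv_impE; [|exact (ev _ (map (@star _) H) _ a)].
    exact (prv_allE a IHd).
  - apply prv_exI with (a := a). unfold inst in *. rewrite star_sub in IHd.
    simpl. apply prv_andI; [apply ev | exact IHd].
  - eapply prv_exE; [exact IHd1|]. unfold wk_form at 2 in IHd2. rewrite star_sub in IHd2.
    (* The available hypothesis is the conjunction of guard and body, whereas [IHd2] has them as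
       separate hypotheses. Both are discharged as implications and then fed the two projections. *)
    eapply prv_impE; [eapply prv_impE with (p := Ext (Var vz))|].
    + apply prv_mono with (H := map (wk_form s) (map (@star _) H ++ ext_vars G));
        [|now apply incl_tl].
      do 2 apply prv_impI. eapply prv_mono; [exact IHd2|].
      rewrite ext_vars_cons, map_star_wk, map_app.
      intros r [<-|i]; [left; reflexivity|].
      simpl. rewrite !in_app_iff in *. simpl in i. tauto.
    + eapply prv_andE1. hyp.
    + eapply prv_andE2. hyp.
Qed.

Lemma prv_ext_premises G (p : form LH G) :
  prv HE_HA (ext_vars G) p -> provable HE_HA (ext_premises p).
Proof.
  unfold provable, ext_premises, ext_vars. intros d.
  (* The empty list is generalized to an accumulator [H] that collects the premises already
     introduced. *)
  rewrite <- (app_nil_r (map _ _)) in d. revert d. generalize (@nil (form LH G)).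
  induction (vars G) as [|v l IH]; intros H d; simpl in *; [exact d|].
  apply prv_impI, IH. eapply prv_mono; [exact d|].
  intros q. simpl. rewrite !in_app_iff. simpl. tauto.
Qed.

(** * Erasure: [Ext] read as truth and [=] as [==] *)

Definition Top {L G} : form L G := Imp Bot Bot.

Definition erase_atom (L : lang) (G : ctx) (a : atom G L) : form LHA G :=
  match a with
  | aeqv _ x y => Eqv x y
  | aeq x y => Eqv x y
  | aext _ => Top
  end.

(** Guards stay in place as [Top] instead of being deleted, so erasure is a homomorphism for all
    connectives and quantifiers and sends each inference rule to itself. *)
Fixpoint erase (G : ctx) (p : form LH G) : form LHA G :=
  match p with
  | Bot => Bot
  | Atom a => erase_atom a
  | And p q => And (erase p) (erase q)
  | Or p q => Or (erase p) (erase q)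
  | Imp p q => Imp (erase p) (erase q)
  | All s p => All s (erase p)
  | Ex s p => Ex s (erase p)
  end.

Lemma erase_sub G D (r : sub G D) (p : form LH G) :
  erase (sub_form r p) = sub_form r (erase p).
Proof.
  revert D r. induction p; intros D r; simpl; try congruence.
  now destruct a.
Qed.

Lemma map_erase_wk G s (H : list (form LH G)) :
  map (@erase _) (map (wk_form s) H) = map (wk_form s) (map (@erase _) H).
Proof. rewrite !map_map. apply map_ext. intros p. apply erase_sub. Qed.

Lemma prv_top L (T : theory L) G H : prv T H (Top : form L G).
Proof. apply prv_imp_refl. Qed.

Lemma HA_erase G (p : form LH G) : HA p -> HA (erase p).
Proof.
  intros a. destruct a; try (constructor; fail).
  simpl. unfold at_succ, inst. rewrite !erase_sub. apply HA_induction.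
Qed.

(** The clauses for [=] at product and arrow types become the extensionality axioms of E-HA^omega,
    up to a [Top] guard in the arrow case; the axioms about [Ext] become trivial. *)
Lemma E_HA_erase_axiom G H (p : form LH G) : HE_HA p -> prv E_HA H (erase p).
Proof.
  intros [q a|s t f x y].
  - destruct a as [q a|x y| |s t x y|s t x|s t f g|s t f x|s x y|s c]; simpl.
    + now apply prv_ax, E_HA_base, HA_erase.
    + apply prv_andI; apply prv_imp_refl.
    + apply prv_allI, prv_top.
    + apply prv_ax, E_HA_prod.
    + apply prv_andI; apply prv_impI; [apply prv_andI|]; apply prv_top.
    + assert (d := prv_ax H (E_HA_fun f g)). apply prv_andI.
      * eapply prv_imp_trans; [exact (prv_andE1 d)|].
        apply prv_imp_all, prv_imp_const.
      * eapply prv_imp_trans; [|exact (prv_andE2 d)].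
        apply prv_imp_all, prv_imp_detach, prv_top.
    + do 2 apply prv_impI. apply prv_top.
    + do 2 apply prv_impI. apply prv_top.
    + apply prv_top.
  (* The erased axiom [HE_HA_ext] is congruence of application, with reflexivity for the function
     part. *)
  - simpl. do 4 apply prv_impI.
    eapply prv_impE; [eapply prv_impE; [apply prv_ax, E_HA_base, HA_cong|]|].
    + apply prv_ax, E_HA_base, HA_refl.
    + hyp.
Qed.

Lemma E_HA_erase G H (p : form LH G) :
  prv HE_HA H p -> prv E_HA (map (@erase _) H) (erase p).
Proof.
  intros d. induction d; simpl in *.
  - now apply E_HA_erase_axiom.
  - now apply prv_hyp, in_map.
  - now apply prv_botE.
  - now apply prv_andI.
  - eapply prv_andE1; eauto.
  - eapply prv_andE2; eauto.
  - now apply prv_orI1.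
  - now apply prv_orI2.
  - eapply prv_orE; eauto.
  - now apply prv_impI.
  - eapply prv_impE; eauto.
  - apply prv_allI. now rewrite <- map_erase_wk.
  - unfold inst. rewrite erase_sub. exact (prv_allE a IHd).
  - apply prv_exI with (a := a). unfold inst in *. now rewrite <- erase_sub.
  - eapply prv_exE; [exact IHd1|]. rewrite <- map_erase_wk.
    unfold wk_form at 2. now rewrite <- erase_sub.
Qed.

(** * Erasure undoes the star, and the equivalence *)

(** The language is made a variable, with a trivial claim at [LH], so that the indexed atom can be
    destructed. *)
Lemma erase_star_atom L G (a : atom G L) :
  match L return atom G L -> Prop with
  | LHA => fun a => erase (star_atom a) = Atom a
  | LH => fun _ => True
  end a.
Proof. now destruct a as [[] s x y|s x y|s x]. Qed.

(** The two formulas differ only by [Top] guards at the quantifiers. Both directions are proved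
    together because implication is contravariant in its premise. *)
Lemma erase_star T G H (p : form LHA G) :
  prv T H (erase (star p) --> p) /\ prv T H (p --> erase (star p)).
Proof.
  revert H. induction p as [G|G a|G p IHp q IHq|G p IHp q IHq|G p IHp q IHq|G s p IHp|G s p IHp];
    intros H; simpl.
  - split; apply prv_imp_refl.
  - rewrite (erase_star_atom a). split; apply prv_imp_refl.
  - split; apply prv_imp_and; apply IHp || apply IHq.
  - split; apply prv_imp_or; apply IHp || apply IHq.
  - split; apply prv_imp_imp; apply IHp || apply IHq.
  - split; apply prv_imp_all.
    + eapply prv_imp_trans; [apply prv_imp_detach, prv_top | apply IHp].
    + eapply prv_imp_trans; [apply IHp | apply prv_imp_const].
  - split; apply prv_imp_ex.
    + eapply prv_imp_trans; [|apply IHp]. apply prv_impI. eapply prv_andE2. hyp.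
    + eapply prv_imp_trans; [apply IHp|]. apply prv_impI, prv_andI; [apply prv_top | hyp].
Qed.

Lemma erase_ext_premises T G H (p : form LH G) :
  prv T H (erase (ext_premises p)) -> prv T H (erase p).
Proof.
  unfold ext_premises. induction (vars G) as [|v l IH]; simpl; [auto|].
  intros d. apply IH. eapply prv_impE; [exact d | apply prv_top].
Qed.

Theorem theorem4p1 (G : ctx) (p : form LHA G) :
  provable E_HA p <-> provable HE_HA (ext_premises (star p)).
Proof.
  split; intros d.
  (* Without hypotheses, the list in [HE_star] reduces to [ext_vars G]. *)
  - apply prv_ext_premises. exact (HE_star d).
  - eapply prv_impE; [exact (proj1 (erase_star E_HA [] p))|].
    apply erase_ext_premises. exact (E_HA_erase d).
Qed.
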